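(* There is a register machine (addition machine) with four integer registers which, on input of an integer $x\geq 0$ with $n$ binary digits, outputs (in some order, each exactly once) all the powers of two $2^e$ occurring in the binary representation $x=\sum_{e\in E}2^e$ of $x$, and which runs in time $O(n)$.
   Context: Model (addition machine): a program is a finite list of numbered lines; the machine has finitely many registers, each holding an arbitrary integer. Allowed commands, each counting as one step, are: $x=y+z$, $x=y+k$, $x=y-z$, $x=y-k$, $x=k-y$, $x=k$ (for registers $x,y,z$, not necessarily distinct, and integer constants $k$); ''read $x$'' and ''write $x$'' (reading/writing a whole integer); ''if $x\,R\,y$ then ... else ...'' and ''if $x\,R\,k$ then ... else ...'' with $R\in\{<,=,>,\neq,\leq,\geq\}$; and ''goto $\ell$'' for a fixed line number $\ell$. Finitely many variables with a fixed finite range of values may also be used and do not count as registers. Running time is the number of executed commands. For example, for $x=13$ the machine outputs $8,4,1$ in some order. *)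

(* Defs.v *)
From mathcomp Require Import all_boot all_order all_algebra.
Set Implicit Arguments.
Unset Strict Implicit.
Unset Printing Implicit Defensive.
Import Order.TTheory GRing.Theory Num.Theory.

Inductive comparison := Clt | Ceq | Cgt | Cne | Cle | Cge.

Definition compare (R : comparison) (a b : int) : bool :=
  match R with
  | Clt => (a < b)%R
  | Ceq => a == b
  | Cgt => (a > b)%R
  | Cne => a != b
  | Cle => (a <= b)%R
  | Cge => (a >= b)%R
  end.

(* An addition machine has [n] integer registers and [m] auxiliary variables
   with values in the finite range ['I_r.+1]; variables of different ranges
   are covered by taking the largest one. The auxiliary variables can be set
   to a constant and compared with a constant, which is enough to realize
   every operation on them in a bounded number of steps. *)
Inductive test (n m r : nat) : Type :=
  | TReg of 'I_n & comparison & 'I_n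
  | TConst of 'I_n & comparison & int
  | TFin of 'I_m & 'I_r.+1.

Arguments TReg {n m r}.
Arguments TConst {n m r}.
Arguments TFin {n m r}.

(* The first argument of an assignment is its target, so that
   [SubRC x y k] is x = y - k and [SubCR x k y] is x = k - y. *)
Inductive command (n m r : nat) : Type :=
  | AddRR of 'I_n & 'I_n & 'I_n
  | AddRC of 'I_n & 'I_n & int
  | SubRR of 'I_n & 'I_n & 'I_n
  | SubRC of 'I_n & 'I_n & int
  | SubCR of 'I_n & int & 'I_n
  | SetC of 'I_n & int
  | Read of 'I_n
  | Write of 'I_n
  | IfThenElse of test n m r & seq (command n m r) & seq (command n m r)
  | Goto of nat
  | SetFin of 'I_m & 'I_r.+1.

Arguments AddRR {n m r}.
Arguments AddRC {n m r}.
Arguments SubRR {n m r}.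
Arguments SubRC {n m r}.
Arguments SubCR {n m r}.
Arguments SetC {n m r}.
Arguments Read {n m r}.
Arguments Write {n m r}.
Arguments IfThenElse {n m r}.
Arguments Goto {n m r}.
Arguments SetFin {n m r}.

(* The lines of a program are numbered from 0. *)
Definition program (n m r : nat) := seq (command n m r).

(* [todo] is the sequence of commands that remain to be executed if no jump
   occurs: the rest of the current block, followed by the subsequent lines.
   [output] lists the written integers in the order of writing. *)
Record config (n m r : nat) := Config {
  todo : seq (command n m r);
  regs : {ffun 'I_n -> int};
  fins : {ffun 'I_m -> 'I_r.+1};
  input : seq int;
  output : seq int }.

Definition update (I : finType) (V : Type) (s : {ffun I -> V}) (i : I) (v : V) :
    {ffun I -> V} :=
  [ffun j => if j == i then v else s j].

Definition eval_test n m r (t : test n m r) (s : {ffun 'I_n -> int})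
    (f : {ffun 'I_m -> 'I_r.+1}) : bool :=
  match t with
  | TReg x R y => compare R (s x) (s y)
  | TConst x R k => compare R (s x) k
  | TFin v a => f v == a
  end.

(* There is no next configuration when the machine has halted, that is, when
   no command remains (the end of the program was reached, or a jump went past
   it), nor when it is stuck trying to read from an exhausted input. *)
Definition step n m r (P : program n m r) (c : config n m r) :
    option (config n m r) :=
  let: Config cs s f inp out := c in
  if cs is cmd :: k then
    match cmd with
    | AddRR x y z => Some (Config k (update s x (s y + s z)%R) f inp out)
    | AddRC x y a => Some (Config k (update s x (s y + a)%R) f inp out)
    | SubRR x y z => Some (Config k (update s x (s y - s z)%R) f inp out)
    | SubRC x y a => Some (Config k (update s x (s y - a)%R) f inp out)
    | SubCR x a y => Some (Config k (update s x (a - s y)%R) f inp out)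
    | SetC x a => Some (Config k (update s x a) f inp out)
    | Read x =>
        if inp is a :: inp' then Some (Config k (update s x a) f inp' out)
        else None
    | Write x => Some (Config k s f inp (rcons out (s x)))
    | IfThenElse t cs1 cs2 =>
        Some (Config ((if eval_test t s f then cs1 else cs2) ++ k) s f inp out)
    | Goto l => Some (Config (drop l P) s f inp out)
    | SetFin v a => Some (Config k s (update f v a) inp out)
    end
  else None.

Definition run n m r (P : program n m r) (t : nat) (c : config n m r) :
    option (config n m r) :=
  iter t (obind (step P)) (Some c).

(* Started with register contents [s] and auxiliary values [f] on the input
   consisting of the single integer [a], the machine halts after executing
   exactly [t] commands, having written [out]. *)
Definition halts_with n m r (P : program n m r) (s : {ffun 'I_n -> int})
    (f : {ffun 'I_m -> 'I_r.+1}) (a : int) (t : nat) (out : seq int) : Prop :=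
  exists c : config n m r,
    [/\ run P t (Config P s f [:: a] [::]) = Some c,
        todo c = [::]
      & output c = out].

(* As [trunc_log 2 0 = 0], the number 0 has one binary digit. *)
Definition binary_digits (x : nat) : nat := (trunc_log 2 x).+1.

(* Main.v *)
Require Import Defs.
From mathcomp Require Import all_boot all_order all_algebra.
From mathcomp Require Import zify.
Set Implicit Arguments.
Unset Strict Implicit.
Unset Printing Implicit Defensive.
Import Order.TTheory GRing.Theory Num.Theory.

(** Doubling a number below [Q = 2 ^ N] and subtracting [Q] upon overflow shifts
    out its binary digits from the top, while doubling [p], starting from 1,
    produces the powers of two from the bottom. Running both in parallel, and
    adding [p] to [y] whenever a digit 1 is shifted out of [x], leaves in [y]
    the [N]-digit reversal of [x]. The digits shifted out of [y] are then those
    of [x] from the bottom, so a second pass can write [p] whenever a digit 1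
    appears; no halving is needed. *)

(** The number of steps is only bounded, since the two branches of a test may take different times;
    this gives every loop round one uniform cost. *)
Definition reach n m r (P : program n m r) (t : nat) (c c' : config n m r) :=
  exists2 k, k <= t & run P k c = Some c'.

Lemma reach_refl n m r (P : program n m r) c : reach P 0 c c.
Proof. by exists 0. Qed.

Lemma reach_trans n m r (P : program n m r) t1 t2 c1 c2 c3 :
  reach P t1 c1 c2 -> reach P t2 c2 c3 -> reach P (t1 + t2) c1 c3.
Proof.
move=> [k1 le1 run1] [k2 le2 run2]; exists (k2 + k1).
  by rewrite addnC leq_add.
by rewrite /run iterD -[iter k1 _ _]/(run P k1 c1) run1.
Qed.

Lemma reach_step n m r (P : program n m r) t c1 c2 c3 :
  step P c1 = Some c2 -> reach P t c2 c3 -> reach P t.+1 c1 c3.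
Proof. by move=> s12; apply: (@reach_trans _ _ _ P 1); exists 1. Qed.

Lemma reach_if n m r (P : program n m r) b tst cs1 cs2 k s f inp out t c :
    eval_test tst s f = b ->
    reach P t (Config ((if b then cs1 else cs2) ++ k) s f inp out) c ->
  reach P t.+1 (Config (IfThenElse tst cs1 cs2 :: k) s f inp out) c.
Proof. by move=> <-; apply: reach_step. Qed.

Lemma reach_weaken n m r (P : program n m r) t1 t2 c1 c2 :
  t1 <= t2 -> reach P t1 c1 c2 -> reach P t2 c1 c2.
Proof. by move=> le12 [k lek runk]; exists k => //; apply: leq_trans le12. Qed.

Lemma reach_iter n m r (P : program n m r) t N (c : nat -> config n m r) :
  (forall j, j < N -> reach P t (c j) (c j.+1)) -> reach P (N * t) (c 0) (c N).
Proof.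
elim: N => [|N IHN] iterc; first exact: reach_refl.
rewrite mulSnr; apply: reach_trans (iterc N _) => //.
by apply: IHN => j ltjN; apply: iterc; apply: ltnW.
Qed.

Definition from_bits (N : nat) (b : nat -> bool) := \sum_(i < N) b i * 2 ^ i.

Lemma from_bitsS N b : from_bits N.+1 b = from_bits N b + b N * 2 ^ N.
Proof. by rewrite /from_bits big_ord_recr. Qed.

Lemma from_bits_lt N b : from_bits N b < 2 ^ N.
Proof.
elim: N => [|N IHN]; first by rewrite /from_bits big_ord0.
rewrite from_bitsS expnS mul2n -addnn -addSn leq_add //.
by case: (b N); rewrite ?mul1n ?mul0n.
Qed.

Lemma bits_exist N x : x < 2 ^ N -> exists b, x = from_bits N b.
Proof.
elim: N x => [|N IHN] x ltx.
  by exists xpred0; rewrite /from_bits big_ord0; case: x ltx.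
have /IHN[b def_x]: x./2 < 2 ^ N by rewrite ltn_half_double -mul2n -expnS.
exists (fun i => if i is j.+1 then b j else odd x).
rewrite /from_bits big_ord_recl /= muln1 -[LHS]odd_double_half def_x.
congr (_ + _); rewrite -muln2 big_distrl /=.
by apply: eq_bigr => i _; rewrite /bump /= add1n expnSr mulnA.
Qed.

Lemma eq_from_bits N b1 b2 :
  (forall i, i < N -> b1 i = b2 i) -> from_bits N b1 = from_bits N b2.
Proof. by move=> eqb; apply: eq_bigr => i _; rewrite eqb. Qed.

Lemma from_bits_filter N b :
  from_bits N b = \sum_(e <- [seq i <- iota 0 N | b i]) 2 ^ e.
Proof.
rewrite big_filter big_mkcond /= -[N in iota 0 N]subn0 big_mkord.
by apply: eq_bigr => i _; case: (b i); rewrite ?mul1n.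
Qed.

(** The content of an [N]-digit register after [j] doublings modulo [2 ^ N]: the top [j] digits are
    gone and the others have moved up. *)
Definition shifted N b j := 2 ^ j * from_bits (N - j) b.

Lemma shifted_lt N b j : j <= N -> shifted N b j < 2 ^ N.
Proof.
by move=> lejN; rewrite -(subnKC lejN) expnD /shifted subnKC // ltn_pmul2l
  ?expn_gt0 ?from_bits_lt.
Qed.

Lemma shiftedS N b j : j < N ->
  shifted N b j + shifted N b j = shifted N b j.+1 + b (N - j.+1) * 2 ^ N.
Proof.
move=> ltjN; rewrite /shifted addnn -mul2n mulnA -expnS.
rewrite -(subnSK ltjN) from_bitsS mulnDr; congr (_ + _).
by rewrite mulnCA -expnD subnKC.
Qed.

(** By [shiftedS] the doubled value is a number below [2 ^ N] plus the outgoing digit times [2 ^ N],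
    so comparing with [2 ^ N] reads off that digit. *)
Lemma shifted_overflow N b j : j < N ->
  (2 ^ N <= shifted N b j + shifted N b j) = b (N - j.+1).
Proof.
move=> ltjN; rewrite shiftedS //.
case: (b _); rewrite ?mul1n ?leq_addl // mul0n addn0.
by apply/negbTE; rewrite -ltnNge shifted_lt.
Qed.

Definition rx : 'I_4 := @Ordinal 4 0 isT.
Definition rq : 'I_4 := @Ordinal 4 1 isT.
Definition rp : 'I_4 := @Ordinal 4 2 isT.
Definition ry : 'I_4 := @Ordinal 4 3 isT.

Definition regs4 (x q p y : int) : {ffun 'I_4 -> int} :=
  [ffun i : 'I_4 => nth 0%R [:: x; q; p; y] i].

(** Brings the arbitrary initial register contents into the form on which [update_regs4]
    computes. *)
Lemma regs4_eta (s : {ffun 'I_4 -> int}) : s = regs4 (s rx) (s rq) (s rp) (s ry).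
Proof.
apply/ffunP=> i; rewrite ffunE.
by case: i => [[|[|[|[|i]]]] lti] //=; congr (s _); apply: val_inj.
Qed.

Lemma regs4E x q p y :
  (regs4 x q p y rx = x) * (regs4 x q p y rq = q) *
  (regs4 x q p y rp = p) * (regs4 x q p y ry = y).
Proof. by rewrite !ffunE. Qed.

Lemma update_regs4 x q p y v :
  (update (regs4 x q p y) rx v = regs4 v q p y) *
  (update (regs4 x q p y) rq v = regs4 x v p y) *
  (update (regs4 x q p y) rp v = regs4 x q v y) *
  (update (regs4 x q p y) ry v = regs4 x q p v).
Proof.
by do !split; apply/ffunP=> i; rewrite !ffunE;
  case: i => [[|[|[|[|i]]]] lti].
Qed.

Definition bits_program : program 4 0 0 := [::
  Read rx;
  SetC rq 2;
  (* 2 *) IfThenElse (TReg rq Cle rx) [:: AddRR rq rq rq; Goto 2] [::];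
  SetC rp 1;
  SetC ry 0;
  (* 5 *) IfThenElse (TReg rp Clt rq)
            [:: AddRR rx rx rx;
                IfThenElse (TReg rx Cge rq)
                  [:: SubRR rx rx rq; AddRR ry ry rp] [::];
                AddRR rp rp rp;
                Goto 5] [::];
  SetC rp 1;
  (* 7 *) IfThenElse (TReg rp Clt rq)
            [:: AddRR ry ry ry;
                IfThenElse (TReg ry Cge rq)
                  [:: SubRR ry ry rq; Write rp] [::];
                AddRR rp rp rp;
                Goto 7] [::]].

Definition at_line l x q p y f out : config 4 0 0 :=
  Config (drop l bits_program) (regs4 x q p y) f [::] out.

Ltac exec := apply: reach_step => //; rewrite ?regs4E ?update_regs4.

(** The first loop doubles [rq] until it exceeds the input; a round costs the test, the addition and
    the jump. *)
Lemma find_power_step x j p y f out : 2 ^ j <= x ->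
  reach bits_program 3 (at_line 2 x (2 ^ j)%N p y f out)
                       (at_line 2 x (2 ^ j.+1)%N p y f out).
Proof.
move=> lex; apply: (@reach_if _ _ _ _ true); first by rewrite /= !regs4E.
do 2!exec; rewrite -PoszD addnn -mul2n -expnS; exact: reach_refl.
Qed.

(** Invariant of the reversing pass: [y j] collects the [j] digits shifted out so far, the former
    top digit lowest. The bound 7 is the cost of a round with outgoing digit 1. *)
Lemma reverse_step N b j f out : j < N ->
  let y j := from_bits j (fun i => b (N - i.+1)) in
  reach bits_program 7
    (at_line 5 (shifted N b j) (2 ^ N)%N (2 ^ j)%N (y j) f out)
    (at_line 5 (shifted N b j.+1) (2 ^ N)%N (2 ^ j.+1)%N (y j.+1) f out).
Proof.
move=> ltjN y; apply: (@reach_if _ _ _ _ true).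
  by rewrite /= !regs4E ltz_nat ltn_exp2l.
exec; apply: (@reach_if _ _ _ _ (b (N - j.+1))).
  by rewrite /= !regs4E lez_nat shifted_overflow.
rewrite -PoszD shiftedS // /y from_bitsS expnS mul2n -addnn.
case: (b (N - j.+1)); rewrite ?mul1n ?mul0n ?addn0.
  do 4!exec; rewrite PoszD addrK; exact: reach_refl.
(* For digit 0 the inner branch is empty, so two commands remain instead of four. *)
apply: (@reach_weaken _ _ _ _ 2) => //; do 2!exec; exact: reach_refl.
Qed.

(** When [b] is a reversed digit sequence, the digit shifted out in round [j] is digit [j] of the
    original number, and [rp] holds just its weight [2 ^ j]. *)
Lemma output_step N b j x f : j < N ->
  let out j := [seq Posz (2 ^ e) | e <- iota 0 j & b (N - e.+1)] in
  reach bits_program 7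
    (at_line 7 x (2 ^ N)%N (2 ^ j)%N (shifted N b j) f (out j))
    (at_line 7 x (2 ^ N)%N (2 ^ j.+1)%N (shifted N b j.+1) f (out j.+1)).
Proof.
move=> ltjN out; apply: (@reach_if _ _ _ _ true).
  by rewrite /= !regs4E ltz_nat ltn_exp2l.
exec; apply: (@reach_if _ _ _ _ (b (N - j.+1))).
  by rewrite /= !regs4E lez_nat shifted_overflow.
rewrite -PoszD shiftedS // /out -[in iota 0 j.+1]addn1 iotaD filter_cat /=.
rewrite add0n expnS mul2n -addnn map_cat.
case: (b (N - j.+1)); rewrite ?mul1n ?mul0n ?addn0 /= ?cats1 ?cats0.
  do 4!exec; rewrite PoszD addrK; exact: reach_refl.
apply: (@reach_weaken _ _ _ _ 2) => //; do 2!exec; exact: reach_refl.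
Qed.

Theorem theorem6 :
  exists (m r : nat) (P : program 4 m r) (C : nat),
    forall (x : nat) (s : {ffun 'I_4 -> int}) (f : {ffun 'I_m -> 'I_r.+1}),
    exists (t : nat) (out : seq int) (E : seq nat),
      [/\ halts_with P s f (Posz x) t out,
          t <= C * binary_digits x,
          uniq E,
          x = \sum_(e <- E) 2 ^ e
        & perm_eq out [seq Posz (2 ^ e) | e <- E]].
Proof.
(* No auxiliary variables are used. The three phases take at most [3 * N], [7 * N + 3] and
   [7 * N + 2] steps, together at most [25 * N] because [N >= 1]. *)
exists 0, 0, bits_program, 25 => x s f.
set N := binary_digits x.
have ltxN : x < 2 ^ N by apply: trunc_log_ltn.
have [b def_x] := bits_exist ltxN.
pose b' i := b (N - i.+1); set E := [seq i <- iota 0 N | b i].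
have find_power : reach bits_program (3 + (N.-1 * 3))
    (Config bits_program s f [:: Posz x] [::])
    (at_line 3 x (2 ^ N)%N (s rp) (s ry) f [::]).
  (* Of the constant 3, two steps precede the loop and one is its final, failing test; the later
     phases are split likewise. *)
  rewrite [s in Config _ s]regs4_eta -[X in X + _]/(2 + 1) addnAC.
  apply: (@reach_trans _ _ _ _ _ _ _ (at_line 2 x (2 ^ N)%N (s rp) (s ry) f [::])).
    do 2!exec.
    (* As [rq] starts at [2 ^ 1], it takes [N - 1] doublings to reach [2 ^ N]. *)
    apply: (@reach_iter _ _ _ _ 3 N.-1
              (fun j => at_line 2 x (2 ^ j.+1)%N (s rp) (s ry) f [::])) => j ltj.
    (* For [x = 0] there is one digit and hence no round; otherwise
       [2 ^ (j + 1) <= 2 ^ (N - 1) <= x]. *)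
    apply: find_power_step; case: (posnP x) => [x0|x_gt0].
      by rewrite /N x0 /binary_digits trunc_log0 in ltj.
    by apply: leq_trans (trunc_logP (ltnSn 1) x_gt0); rewrite leq_exp2l.
  apply: (@reach_if _ _ _ _ false); last exact: reach_refl.
  by rewrite /= !regs4E lez_nat leqNgt ltxN.
have reverse : reach bits_program (3 + N * 7)
    (at_line 3 x (2 ^ N)%N (s rp) (s ry) f [::])
    (at_line 6 (shifted N b N) (2 ^ N)%N (2 ^ N)%N (from_bits N b') f [::]).
  rewrite -[3]/(2 + 1) addnAC; apply: reach_trans.
    do 2!exec; have := @reach_iter _ _ _ bits_program 7 N _
      (fun j => @reverse_step N b j f [::]).
    by rewrite /shifted subn0 mul1n -def_x /from_bits big_ord0; apply.
  apply: (@reach_if _ _ _ _ false); last exact: reach_refl.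
  by rewrite /= !regs4E ltxx.
have output_powers : reach bits_program (2 + N * 7)
    (at_line 6 (shifted N b N) (2 ^ N)%N (2 ^ N)%N (from_bits N b') f [::])
    (at_line 8 (shifted N b N) (2 ^ N)%N (2 ^ N)%N (shifted N b' N) f
       [seq Posz (2 ^ e) | e <- E]).
  rewrite -[2]/(1 + 1) addnAC; apply: reach_trans.
    exec; have -> : from_bits N b' = shifted N b' 0.
      by rewrite /shifted subn0 mul1n.
    have := @reach_iter _ _ _ bits_program 7 N _
      (fun j => @output_step N b' j (shifted N b N) f).
    by apply.
  apply: (@reach_if _ _ _ _ false); first by rewrite /= !regs4E ltxx.
  (* Reversing twice restores the digits, so the exponents written are those in [E]. *)
  have -> : E = [seq e <- iota 0 N | b' (N - e.+1)].
    apply: eq_in_filter => e; rewrite mem_iota /= add0n => lteN.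
    by rewrite /b' subnSK // subKn // ltnW.
  exact: reach_refl.
have [t le_t run_t] := reach_trans find_power (reach_trans reverse output_powers).
exists t, [seq Posz (2 ^ e) | e <- E], E; split.
- by eexists; split; first exact: run_t.
- apply: leq_trans le_t _; rewrite /N /binary_digits.
  by rewrite succnK; move: (trunc_log 2 x) => k; lia.
- by rewrite filter_uniq ?iota_uniq.
- by rewrite {1}def_x from_bits_filter.
- exact: perm_refl.
Qed.
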